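(* Let $f:\mathbb{N}\to(0,\infty)$ be an attachment function that grows at most linearly, i.e. $\limsup_{n\to\infty} f(n)/n < \infty$, and satisfies $\inf_{n\in\mathbb{N}} f(n) > 0$. Let $X_n$ be the number of vertices of the largest common (unlabeled) subtree of two independent random trees with $n$ vertices each, both generated by the randomly growing tree model with attachment function $f$. Then there exists $\varepsilon = \varepsilon(f) > 0$ such that for all $n \geq 1$, $$\mathbb{E}[X_n] \geq n^{\varepsilon} .$$
   Context: $\mathbb{N}=\{1,2,3,\ldots\}$. The randomly growing tree model with attachment function $f$: $T_1$ is a single vertex, $T_2$ is the unique tree on two vertices, and for $n\ge 2$, given $T_n$ with vertices $v_1,\ldots,v_n$, the tree $T_{n+1}$ is formed by adding a new vertex $v_{n+1}$ and joining it by an edge to a random existing vertex $u$ with $$\mathbb{P}(u = v_i \mid T_n) = \frac{f(d_{T_n}(v_i))}{\sum_{j=1}^n f(d_{T_n}(v_j))},$$ where $d_{T_n}(v)$ is the degree of $v$ in $T_n$. The size of the largest common subtree of two finite trees $T^1,T^2$ (viewed as unlabeled, unrooted graphs) is the maximum of $|S|$ (number of vertices of $S$) over all trees $S$ isomorphic both to a subtree of $T^1$ and to a subtree of $T^2$. *)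

(* Defs.v *)
From HB Require Import structures.
From mathcomp Require Import all_boot all_order all_algebra.
From mathcomp Require Import boolp reals.

Set Implicit Arguments.
Unset Strict Implicit.
Unset Printing Implicit Defensive.

Import Order.TTheory GRing.Theory Num.Theory.
Local Open Scope ring_scope.

(* A finite graph inside an ambient finite type V is a pair (vertex set, edge
   set). The edge set is a set of ordered pairs; an undirected edge {x, y} is
   represented by both (x, y) and (y, x), see [simple_graph]. *)
Definition graph (V : finType) : Type := ({set V} * {set V * V})%type.
Definition verts (V : finType) (G : graph V) : {set V} := G.1.
Definition edges (V : finType) (G : graph V) : {set V * V} := G.2.
Definition adj (V : finType) (G : graph V) : rel V :=
  fun x y => (x, y) \in edges G.

Definition degree (V : finType) (G : graph V) (v : V) : nat :=
  #|[set w | adj G v w]|.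

Definition simple_graph (V : finType) (G : graph V) : Prop :=
  [/\ symmetric (adj G), irreflexive (adj G)
    & forall x y, adj G x y -> x \in verts G /\ y \in verts G].

Definition connected_graph (V : finType) (G : graph V) : Prop :=
  verts G != set0 /\ {in verts G &, forall x y, connect (adj G) x y}.

Definition acyclic_graph (V : finType) (G : graph V) : Prop :=
  forall c : seq V, (2 < size c)%N -> ~ ucycle (adj G) c.

Definition tree (V : finType) (G : graph V) : Prop :=
  [/\ simple_graph G, connected_graph G & acyclic_graph G].

Definition subgraph (V : finType) (H G : graph V) : Prop :=
  verts H \subset verts G /\ edges H \subset edges G.

Definition isomorphic (U V : finType) (G : graph U) (H : graph V) : Prop :=
  exists phi : U -> V,
    [/\ {in verts G &, injective phi},
        [set phi x | x in verts G] = verts H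
      & {in verts G &, forall x y, adj H (phi x) (phi y) = adj G x y}].

Definition iso_to_subtree (U V : finType) (S : graph U) (T : graph V) : Prop :=
  exists H : graph V, [/\ subgraph H T, tree H & isomorphic S H].

Definition common_subtree_of_size (V1 V2 : finType)
    (T1 : graph V1) (T2 : graph V2) (k : nat) : Prop :=
  exists (U : finType) (S : graph U),
    [/\ tree S, iso_to_subtree S T1, iso_to_subtree S T2 & #|verts S| = k].

(* The bound on k only makes the maximum range over a finite set: a graph
   isomorphic to a subgraph of T1 has at most #|verts T1| vertices. *)
Definition largest_common_subtree (V1 V2 : finType)
    (T1 : graph V1) (T2 : graph V2) : nat :=
  (\max_(k < #|verts T1|.+1 | `[< common_subtree_of_size T1 T2 k >]) k)%N.

Definition single_vertex : graph 'I_1 := ([set: 'I_1], set0).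

(* The old vertices of the new graph are 0, ..., n - 1 (the image of
   [lift ord_max], which preserves values); the new vertex is [ord_max]. *)
Definition attach (n : nat) (G : graph 'I_n) (u : 'I_n) : graph 'I_n.+1 :=
  let old := lift (@ord_max n) in
  (ord_max |: [set old x | x in verts G],
   [set (ord_max, old u); (old u, ord_max)] :|:
   [set (old e.1, old e.2) | e in edges G]).

Definition attach_prob (R : realType) (f : nat -> R) (n : nat)
    (G : graph 'I_n) (u : 'I_n) : R :=
  f (degree G u) / \sum_(j < n) f (degree G j).

(* One step of the chain: the law of T_(n+1), given the law mu of T_n. *)
Definition growth_step (R : realType) (f : nat -> R) (n : nat)
    (mu : graph 'I_n -> R) : graph 'I_n.+1 -> R :=
  fun G' => \sum_(G : graph 'I_n)
    mu G * \sum_(u < n) attach_prob f G u * (G' == attach G u)%:R.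

(* The law of T_(k+2). *)
Fixpoint growing_tree_law2 (R : realType) (f : nat -> R) (k : nat) :
    graph 'I_k.+2 -> R :=
  match k return graph 'I_k.+2 -> R with
  | 0 => fun G => (G == attach single_vertex ord0)%:R
  | k'.+1 => growth_step f (growing_tree_law2 f (k := k'))
  end.

(* [growing_tree_law f G] is the probability that T_n = G, for G : graph 'I_n.
   T_1 and T_2 are deterministic, so f 0 only occurs in terms of weight 0;
   n = 0 is a dummy case. *)
Definition growing_tree_law (R : realType) (f : nat -> R) (n : nat) :
    graph 'I_n -> R :=
  match n return graph 'I_n -> R with
  | 0 => fun _ => 0
  | 1 => fun G => (G == single_vertex)%:R
  | k.+2 => growing_tree_law2 f (k := k)
  end.

(* Expectation of the size of the largest common subtree under the product of
   two copies of the law of T_n. *)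
Definition expected_largest_common_subtree (R : realType) (f : nat -> R)
    (n : nat) : R :=
  \sum_(T1 : graph 'I_n) \sum_(T2 : graph 'I_n)
    growing_tree_law f T1 * growing_tree_law f T2 *
    (largest_common_subtree T1 T2)%:R.

(* Main.v *)
Require Import Defs.
From HB Require Import structures.
From mathcomp Require Import all_classical all_reals all_analysis.
From mathcomp Require Import all_boot all_order all_algebra ring lra.

Set Implicit Arguments.
Unset Strict Implicit.
Unset Printing Implicit Defensive.

Import Order.TTheory GRing.Theory Num.Theory.
Local Open Scope ring_scope.

(** Pick constants with [c <= f d <= C * d] for all [d >= 1]. The degrees of a
    tree with [n] vertices sum to at most [2 * n], so every vertex of [T_n],
    whatever the past, receives the next leaf with probability at least
    [alpha / n], where [alpha := c / (2 * C)]. This uniform lower bound is all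
    that is used about the growth rule.

    Let the two trees grow side by side, and maintain a common subtree, given
    as a set [s] of matched pairs of vertices. Waiting for both trees to attach
    a leaf to the same matched pair at the same time would be hopeless: this
    has probability of order [1 / n ^ 2] per pair. A leaf of the first tree is
    therefore stored: when it is attached to a matched vertex [u], the edge is
    kept in a set [p] of pending edges, and as soon as the second tree attaches
    a leaf to the partner of [u], the two leaves are matched with each other. A
    pair is idle as long as it has no pending edge and waiting afterwards.
    With the score [2 * #|s| + #|p|], a leaf attached in the first tree to an
    idle pair gains 1, and a leaf attached in the second tree to a waiting pair
    also gains 1 (one more matched pair, one pending edge less). In each step
    an idle pair produces its gain with probability at least [alpha / n], and
    so does a waiting pair; hence the expected gain is at least
    [alpha / n * #|s|], which is at least [alpha / 3 / n] times the score,
    because [#|p| <= #|s|] ([best_score_drift]).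

    Consequently the expectation of the best score [best_score T1 T2], the
    maximum over all such pairs [(s, p)], is multiplied by at least
    [1 + eps / n] in the step from [n] to [n + 1], with [eps := alpha / 3]
    ([mean_best_score_step]). By Bernoulli's inequality this factor is at least
    [((n + 1) / n) `^ eps], so this expectation is at least [3 * n `^ eps]. A
    score is at most [3 * #|s|], and [s] spans a common subtree with [#|s|]
    vertices ([tree_match_common]); dividing by 3 gives the bound. Neither
    concentration nor independence inside one tree is involved: the
    independence of the two trees only serves to let the one-step gains in the
    two coordinates add up. *)

(** * Trees and leaves *)

Definition add_leaf (V : finType) (G : graph V) (u x : V) : graph V :=
  (x |: verts G, [set (u, x); (x, u)] :|: edges G).

Lemma adj_add_leaf (V : finType) (G : graph V) (u x y z : V) :
  adj (add_leaf G u x) y z =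
  [|| (y == u) && (z == x), (y == x) && (z == u) | adj G y z].
Proof. by rewrite /adj /add_leaf /edges /= !inE !xpair_eqE orbA. Qed.

(** A cycle through the new vertex [x] would use two distinct neighbours of
    [x], namely its predecessor and its successor, but [u] is the only one. *)
Lemma tree_add_leaf (V : finType) (G : graph V) (u x : V) :
  tree G -> u \in verts G -> x \notin verts G -> tree (add_leaf G u x).
Proof.
move=> [[sG iG vG] [nG cG] aG] uG xG.
have ux : (u == x) = false by apply: contraNF xG => /eqP <-.
have sub : subrel (adj G) (adj (add_leaf G u x)).
  by move=> y z yz; rewrite adj_add_leaf yz !orbT.
have s' : symmetric (adj (add_leaf G u x)).
  move=> y z; rewrite !adj_add_leaf sG.
  by rewrite orbCA ![(z == _) && _]andbC.
split.
- split=> //.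
    move=> y; rewrite adj_add_leaf iG orbF.
    by apply/negP => /orP[] /andP[/eqP-> ]; rewrite ?ux // eq_sym ux.
  move=> y z; rewrite adj_add_leaf /add_leaf /verts /= !inE.
  case/or3P => [/andP[/eqP-> /eqP->]|/andP[/eqP-> /eqP->]|/vG[-> ->]];
    by rewrite ?eqxx ?uG ?orbT.
- split; first by apply/set0Pn; exists x; rewrite !inE eqxx.
  have cu y : y \in verts (add_leaf G u x) ->
      connect (adj (add_leaf G u x)) u y.
    rewrite /verts /= !inE => /orP[/eqP->|yG].
      by apply: connect1; rewrite adj_add_leaf !eqxx.
    apply: (connect_sub _ (cG _ _ uG yG)) => a b ab.
    exact/connect1/sub.
  move=> y z yG zG; apply: connect_trans (cu z zG).
  by rewrite (sym_connect_sym s') cu.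
- move=> c c2 cc.
  have [xc|xc] := boolP (x \in c); last first.
    case/andP: cc => cc uc; apply: (aG c c2); rewrite /ucycle uc andbT.
    apply: (@sub_in_cycle _ (predC1 x)) cc.
      move=> y z; rewrite !inE => yx zx.
      by rewrite adj_add_leaf (negbTE yx) (negbTE zx) !(andbF, andbT).
    by apply/allP=> y yc /=; apply: contraNneq xc => <-.
  (* Rotate the cycle so that it starts at [x]: both its second and its last
     entry are then neighbours of [x]. *)
  have [i c' rc] := rot_to xc.
  move: cc; rewrite -(rot_ucycle i) rc.
  have: (2 < size (x :: c'))%N by rewrite -rc size_rot.
  case: c' {rc} => [//|y [//|z c']] _ /andP[].
  have xu w : adj (add_leaf G u x) x w -> w = u.
    rewrite adj_add_leaf eq_sym ux eqxx /= => /orP[/eqP//|/vG[xG']].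
    by rewrite xG' in xG.
  rewrite /= => /andP[/xu-> /andP[_]].
  rewrite rcons_path => /andP[_]; rewrite s' => /xu lu.
  by rewrite -lu mem_last andbF.
Qed.

(** * Matchings that span a common subtree *)

(** The matched pairs are added one leaf at a time, simultaneously in both
    graphs. Only the edges through which leaves are added are required to
    correspond, which suffices since a subtree need not be induced. *)
Inductive tree_match (V W : finType) (G1 : graph V) (G2 : graph W) :
    {set V * W} -> Prop :=
| match_root x y : x \in verts G1 -> y \in verts G2 ->
    tree_match G1 G2 [set (x, y)]
| match_leaf (s : {set V * W}) u v x y : tree_match G1 G2 s -> (u, v) \in s ->
    adj G1 u x -> adj G2 v y -> x \notin fst @: s -> y \notin snd @: s ->
    tree_match G1 G2 ((x, y) |: s).

Lemma tree_match_inj (V W : finType) (G1 : graph V) (G2 : graph W)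
    (s : {set V * W}) : tree_match G1 G2 s ->
  {in s &, injective fst} /\ {in s &, injective snd}.
Proof.
elim=> {s} [x y _ _|s u v x y _ [i1 i2] _ _ _ xs ys].
  by split=> a b /set1P-> /set1P->.
split=> a b /setU1P[->|sa] /setU1P[->|sb] //=; first 2 last.
- exact: i1.
- by move=> e; case/imsetP: ys; exists b.
- by move=> e; case/imsetP: ys; exists a.
- exact: i2.
- by move=> e; case/imsetP: xs; exists b.
- by move=> e; case/imsetP: xs; exists a.
Qed.

Lemma isomorphic_refl (V : finType) (G : graph V) : isomorphic G G.
Proof. by exists id; split=> //; apply: imset_id. Qed.

(** The edges followed while building [s] form a tree on each side, and
    sending each vertex to its partner is an isomorphism between the two; all
    this is preserved by adding a leaf on both sides. *)
Lemma tree_match_common (V W : finType) (G1 : graph V) (G2 : graph W)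
    (s : {set V * W}) :
  simple_graph G1 -> simple_graph G2 -> tree_match G1 G2 s ->
  common_subtree_of_size G1 G2 #|s|.
Proof.
move=> gG1 gG2 ms.
have [i1 i2] := tree_match_inj ms.
suff [H1 [H2 [phi [[t1 t2] [sub1 sub2] [v1 v2] ephi aphi]]]] :
  exists (H1 : graph V) (H2 : graph W) (phi : V -> W),
  [/\ tree H1 /\ tree H2, subgraph H1 G1 /\ subgraph H2 G2,
      verts H1 = fst @: s /\ verts H2 = snd @: s,
      {in s, forall q, phi q.1 = q.2}
    & {in verts H1 &, forall a b, adj H2 (phi a) (phi b) = adj H1 a b}].
  exists V, H1; split=> //; last by rewrite v1 card_in_imset.
    by exists H1; split=> //; apply: isomorphic_refl.
  exists H2; split=> //; exists phi; split=> //.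
    rewrite v1 => _ _ /imsetP[p sp ->] /imsetP[q sq ->].
    by rewrite !ephi // => /i2 ->.
  by rewrite v1 v2 -imset_comp; apply: eq_in_imset.
elim: {i1 i2} ms => {s} [x y xG yG|s u v x y ms IH uvs ux vy xs ys].
  have t0 (U : finType) (z : U) : tree ([set z], set0 : {set U * U}).
    split; first by split=> [a b|a|a b]; rewrite /adj /= !inE.
      split; first by apply/set0Pn; exists z; rewrite inE.
      by move=> a b /set1P-> /set1P->; apply: connect0.
    by move=> [//|a [//|b c]] _ /andP[]; rewrite /= /adj inE.
  exists ([set x], set0), ([set y], set0), (fun=> y).
  split; [split; exact: t0| | | |].
  - by split; split; rewrite ?sub0set // sub1set.
  - by rewrite !imset_set1.
  - by move=> q /set1P->.
  - by move=> a b _ _; rewrite /adj !inE.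
have [i1 i2] := tree_match_inj ms.
have [H1 [H2 [phi [[t1 t2] [sub1 sub2] [v1 v2] ephi aphi]]]] := IH.
have uH : u \in verts H1 by rewrite v1; apply/imsetP; exists (u, v).
have vH : v \in verts H2 by rewrite v2; apply/imsetP; exists (u, v).
rewrite -v1 in xs; rewrite -v2 in ys.
have leaf_sub (U : finType) (G H : graph U) a b : simple_graph G ->
    subgraph H G -> adj G a b -> subgraph (add_leaf H a b) G.
  move=> [sG _ vG] [vs es] ab; have [_ bG] := vG _ _ ab.
  split; rewrite subUset ?sub1set ?bG //= es andbT.
  by apply/subsetP=> q /set2P[]->; rewrite -/(adj G _ _) // sG.
exists (add_leaf H1 u x), (add_leaf H2 v y),
  (fun z => if z == x then y else phi z).
split.
- by split; apply: tree_add_leaf.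
- by split; exact: leaf_sub.
- by split; rewrite imsetU1 /verts /= -/(verts _) ?v1 ?v2.
- move=> q /setU1P[->|sq] /=; first by rewrite eqxx.
  case: eqP => [qx|_]; last exact: ephi.
  by case/negP: xs; rewrite v1 -qx imset_f.
- have phiH a : a \in verts H1 -> phi a \in verts H2.
    by rewrite v1 v2 => /imsetP[q sq ->]; rewrite ephi // imset_f.
  have neq1 a : a \in verts H1 -> (a == x) = false.
    by move=> aH; apply: contraNF xs => /eqP <-.
  have neq2 a : a \in verts H2 -> (a == y) = false.
    by move=> aH; apply: contraNF ys => /eqP <-.
  have phiu a : a \in verts H1 -> (phi a == v) = (a == u).
    rewrite v1 => /imsetP[q sq ->]; rewrite ephi //.
    apply/eqP/eqP => [qv|qu].
      by have -> : q = (u, v) by apply: i2.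
    by have -> : q = (u, v) by apply: i1.
  have [[sH1 iH1 vH1] _ _] := t1; have [[sH2 iH2 vH2] _ _] := t2.
  have nx a : adj H1 x a = false by apply: contraNF xs => /vH1[].
  have ny a : adj H2 y a = false by apply: contraNF ys => /vH2[].
  have vy' : (y == v) = false by rewrite eq_sym neq2.
  have ux' : (x == u) = false by rewrite eq_sym neq1.
  move=> a b; rewrite /= !inE !adj_add_leaf.
  case: (eqVneq a x) => [->|_] /=; case: (eqVneq b x) => [->|_] //=.
  + by rewrite !eqxx nx ny vy' ux'.
  + by move=> _ bH; rewrite !eqxx nx ny vy' ux' phiu.
  + by move=> aH _; rewrite !eqxx sH1 sH2 nx ny neq2 ?phiH // phiu.
  + by move=> aH bH; rewrite !(neq2 (phi _)) ?phiH // !andbF aphi.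
Qed.

(** * Matchings with pending edges *)

Definition graph_embedding (V V' : finType) (G : graph V) (G' : graph V')
    (f : V -> V') : Prop :=
  [/\ injective f, {homo f : x / x \in verts G >-> x \in verts G'}
    & {homo f : x y / adj G x y >-> adj G' x y}].

(** The edges [p] hang off matched vertices of the first graph and lead to
    distinct unmatched vertices, at most one for each matched vertex; each of
    them awaits a counterpart in the second graph. *)
Definition config (V W : finType) (G1 : graph V) (G2 : graph W)
    (s : {set V * W}) (p : {set V * V}) : Prop :=
  [/\ tree_match G1 G2 s,
      {in p, forall e,
         [/\ e.1 \in fst @: s, adj G1 e.1 e.2 & e.2 \notin fst @: s]},
      {in p &, injective fst} & {in p &, injective snd}].

(** A pending edge counts for half a matched pair, so that creating a pending
    edge and completing it are two steps of the same gain. *)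
Definition score (V W : finType) (s : {set V * W}) (p : {set V * V}) : nat :=
  (2 * #|s| + #|p|)%N.

(** A leaf attached to an idle vertex of the first graph, or to a waiting vertex
    of the second graph, increases the score. *)
Definition idle (V W : finType) (s : {set V * W}) (p : {set V * V}) : {set V} :=
  [set q.1 | q in s & q.1 \notin fst @: p].

Definition waiting (V W : finType) (s : {set V * W}) (p : {set V * V}) :
    {set W} :=
  [set q.2 | q in s & q.1 \in fst @: p].

Definition pair_map (V V' W W' : Type) (f : V -> V') (g : W -> W')
    (q : V * W) : V' * W' := (f q.1, g q.2).

Lemma pair_map_inj (V V' W W' : Type) (f : V -> V') (g : W -> W') :
  injective f -> injective g -> injective (pair_map f g).
Proof. by move=> fI gI [a b] [c d] [/fI-> /gI->]. Qed.

Lemma fst_pair_map (V V' W W' : finType) (f : V -> V') (g : W -> W')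
    (s : {set V * W}) : fst @: (pair_map f g @: s) = f @: (fst @: s).
Proof. by rewrite -!imset_comp. Qed.

Lemma snd_pair_map (V V' W W' : finType) (f : V -> V') (g : W -> W')
    (s : {set V * W}) : snd @: (pair_map f g @: s) = g @: (snd @: s).
Proof. by rewrite -!imset_comp. Qed.

Section Embedding.
Variables (V V' W W' : finType).
Variables (G1 : graph V) (G1' : graph V') (f : V -> V').
Variables (G2 : graph W) (G2' : graph W') (g : W -> W').
Hypothesis embf : graph_embedding G1 G1' f.
Hypothesis embg : graph_embedding G2 G2' g.

Lemma tree_match_embedding (s : {set V * W}) :
  tree_match G1 G2 s -> tree_match G1' G2' (pair_map f g @: s).
Proof.
have [[fI fv fe] [gI gv ge]] := (embf, embg).
elim=> {s} [x y xG yG|s u v x y _ IH uvs ux vy xs ys].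
  by rewrite imset_set1; apply: match_root; [apply: fv|apply: gv].
rewrite imsetU1; apply: (@match_leaf _ _ _ _ _ (f u) (g v)).
- exact: IH.
- by apply/imsetP; exists (u, v).
- exact: fe.
- exact: ge.
- by rewrite fst_pair_map mem_imset.
- by rewrite snd_pair_map mem_imset.
Qed.

Lemma config_embedding (s : {set V * W}) (p : {set V * V}) :
  config G1 G2 s p ->
  config G1' G2' (pair_map f g @: s) (pair_map f f @: p).
Proof.
have [[fI fv fe] [gI gv ge]] := (embf, embg).
move=> [ms ps p1 p2]; split.
- exact: tree_match_embedding.
- move=> _ /imsetP[e /ps[es ea en] ->] /=.
  by rewrite fst_pair_map !mem_imset //; split=> //; apply: fe.
- by move=> _ _ /imsetP[d dp ->] /imsetP[e ep ->] /fI/p1 ->.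
- by move=> _ _ /imsetP[d dp ->] /imsetP[e ep ->] /fI/p2 ->.
Qed.

End Embedding.

Section Config.
Variables (V W : finType) (G1 : graph V) (G2 : graph W).
Implicit Types (s : {set V * W}) (p : {set V * V}).

Lemma config_of_match s : tree_match G1 G2 s -> config G1 G2 s set0.
Proof. by move=> ms; split=> [|e|e e'|e e']; rewrite ?inE. Qed.

Lemma config_pending s p u x : config G1 G2 s p ->
    u \in fst @: s -> u \notin fst @: p ->
    adj G1 u x -> x \notin fst @: s -> x \notin snd @: p ->
  config G1 G2 s ((u, x) |: p).
Proof.
move=> [ms ps p1 p2] us up ux xs xp; split=> //.
- by move=> e /setU1P[->|/ps].
- move=> d e /setU1P[->|dp] /setU1P[->|ep] //=; last exact: p1.
    by move=> h; rewrite h imset_f in up.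
  by move=> h; rewrite -h imset_f in up.
- move=> d e /setU1P[->|dp] /setU1P[->|ep] //=; last exact: p2.
    by move=> h; rewrite h imset_f in xp.
  by move=> h; rewrite -h imset_f in xp.
Qed.

Lemma config_matched s p u v x y : config G1 G2 s p ->
    (u, x) \in p -> (u, v) \in s -> adj G2 v y -> y \notin snd @: s ->
  config G1 G2 ((x, y) |: s) (p :\ (u, x)).
Proof.
move=> [ms ps p1 p2] uxp uvs vy ys; have [_ ux xs] := ps _ uxp.
have pD : {subset p :\ (u, x) <= p} by move=> e /setD1P[].
split; last 2 first.
- exact: sub_in2 p1.
- exact: sub_in2 p2.
- exact: match_leaf ux vy xs ys.
- move=> e /setD1P[ne ep]; have [es ea en] := ps _ ep.
  rewrite imsetU1 !inE es orbT negb_or en andbT; split=> //.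
  by apply: contra_neq ne => /= ex; apply: p2.
Qed.

(** Each matched pair is counted once, by its first vertex if it has no pending
    edge and by its second one otherwise. *)
Lemma card_idle_waiting s p : config G1 G2 s p ->
  (#|idle s p| + #|waiting s p|)%N = #|s|.
Proof.
move=> [/tree_match_inj[i1 i2] _ _ _].
rewrite card_in_imset; last by apply: sub_in2 i1 => q; rewrite inE => /andP[].
rewrite card_in_imset; last by apply: sub_in2 i2 => q; rewrite inE => /andP[].
rewrite -(cardsID [set q : V * W | q.1 \in fst @: p] s) addnC.
by congr (_ + _)%N; apply: eq_card => q; rewrite !inE // andbC.
Qed.

Lemma score_le s p : config G1 G2 s p -> (score s p <= 3 * #|s|)%N.
Proof.
move=> [/tree_match_inj[i1 _] ps p1 _].
rewrite /score -[3%N]/(2 + 1)%N mulnDl leq_add2l mul1n.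
rewrite -(card_in_imset p1) -(card_in_imset i1); apply: subset_leq_card.
by apply/subsetP=> _ /imsetP[e /ps[es _ _] ->].
Qed.

Definition best_score : nat :=
  (\max_(c : {set V * W} * {set V * V} | `[< config G1 G2 c.1 c.2 >])
     score c.1 c.2)%N.

Lemma score_le_best s p : config G1 G2 s p -> (score s p <= best_score)%N.
Proof.
move=> c; rewrite /best_score.
by apply: (leq_bigmax_cond (s, p)); apply/asboolP.
Qed.

Lemma best_score_attained x y : x \in verts G1 -> y \in verts G2 ->
  exists s p, config G1 G2 s p /\ best_score = score s p.
Proof.
move=> xG yG; rewrite /best_score.
set P := fun c : {set V * W} * {set V * V} => `[< config G1 G2 c.1 c.2 >].
have P0 : P ([set (x, y)], set0) by apply/asboolP/config_of_match/match_root.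
have [|[s p] Psp ->] := @eq_bigmax_cond _ P (fun c => score c.1 c.2).
  by apply/card_gt0P; exists ([set (x, y)], set0).
by exists s, p; split=> //; apply/asboolP.
Qed.

Lemma leq_largest_common_subtree k :
  common_subtree_of_size G1 G2 k -> (k <= largest_common_subtree G1 G2)%N.
Proof.
move=> ck; have [U [S [_ [H [[vH _] _ [phi [phiI vS _]]]] _ kE]]] := ck.
have kG : (k < #|verts G1|.+1)%N.
  by rewrite ltnS -kE -(card_in_imset phiI) vS subset_leq_card.
rewrite /largest_common_subtree.
by apply: (leq_bigmax_cond (Ordinal kG)); apply/asboolP.
Qed.

Lemma best_score_le : simple_graph G1 -> simple_graph G2 ->
    verts G1 != set0 -> verts G2 != set0 ->
  (best_score <= 3 * largest_common_subtree G1 G2)%N.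
Proof.
move=> gG1 gG2 /set0Pn[x xG] /set0Pn[y yG].
have [s [p [c ->]]] := best_score_attained xG yG.
apply: leq_trans (score_le c) _; rewrite leq_mul2l /=.
by apply/leq_largest_common_subtree/tree_match_common; case: c.
Qed.

End Config.

(** * Attaching a leaf *)

Section Attach.
Variables (n : nat) (G : graph 'I_n) (u : 'I_n).
Let old : 'I_n -> 'I_n.+1 := lift (@ord_max n).

Let old_inj : injective old. Proof. exact: lift_inj. Qed.

Lemma adj_attach_old x y : adj (attach G u) (old x) (old y) = adj G x y.
Proof.
rewrite /adj /attach /edges /= !inE !xpair_eqE.
rewrite ![_ == ord_max]eq_sym !(negbTE (neq_lift _ _)) !(andbF, andFb) /=.
apply/imsetP/idP => [[[a b] ab /eqP]|xy].
  by rewrite xpair_eqE !(inj_eq old_inj) => /andP[/eqP-> /eqP->].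
by exists (x, y).
Qed.

Lemma adj_attach_new x : adj (attach G u) ord_max x = (x == old u).
Proof.
rewrite /adj /attach /edges /= !inE !xpair_eqE eqxx /=.
rewrite (negbTE (neq_lift _ _)) /=.
case: eqVneq => //= _; apply/imsetP => -[[a b] _ /eqP].
by rewrite xpair_eqE (negbTE (neq_lift _ _)).
Qed.

Lemma attach_embedding : graph_embedding G (attach G u) old.
Proof.
split; first exact: old_inj.
  by move=> x xG; rewrite /attach /verts /= !inE imset_f ?orbT.
by move=> x y; rewrite adj_attach_old.
Qed.

Lemma adj_old_new : adj (attach G u) (old u) ord_max.
Proof. by rewrite /adj /attach /edges /= !inE eqxx orbT. Qed.

End Attach.

(** Both gains are realised from the same configuration [s], [p], which makes
    their expectations additive below. An edge that has just become pending
    does not interfere with the completion of an older one. *)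
Lemma config_attach (m n : nat) (G1 : graph 'I_m) (G2 : graph 'I_n)
    (s : {set 'I_m * 'I_n}) (p : {set 'I_m * 'I_m}) (u : 'I_m) (v : 'I_n) :
  config G1 G2 s p ->
  exists s' p', config (attach G1 u) (attach G2 v) s' p' /\
    score s' p' = (score s p + (u \in idle s p) + (v \in waiting s p))%N.
Proof.
move=> c; have lift1_inj := @lift_inj _ (@ord_max m).
have lift2_inj := @lift_inj _ (@ord_max n).
have new1 x : lift ord_max x != ord_max :> 'I_m.+1 by rewrite eq_sym neq_lift.
have new2 x : lift ord_max x != ord_max :> 'I_n.+1 by rewrite eq_sym neq_lift.
have := config_embedding (attach_embedding G1 u) (attach_embedding G2 v) c.
set s1 := _ @: s; set p1 := _ @: p => c1.
have cs1 : #|s1| = #|s| by apply/card_imset/pair_map_inj.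
have cp1 : #|p1| = #|p| by apply/card_imset/pair_map_inj.
have fs1 : fst @: s1 = lift ord_max @: (fst @: s) by apply: fst_pair_map.
have ss1 : snd @: s1 = lift ord_max @: (snd @: s) by apply: snd_pair_map.
have fp1 : fst @: p1 = lift ord_max @: (fst @: p) by apply: fst_pair_map.
have sp1 : snd @: p1 = lift ord_max @: (snd @: p) by apply: snd_pair_map.
have mx1 (A : {set 'I_m}) : (ord_max \notin lift ord_max @: A).
  by apply/imsetP => -[x _ /eqP]; rewrite eq_sym (negbTE (new1 x)).
have mx2 (A : {set 'I_n}) : (ord_max \notin lift ord_max @: A).
  by apply/imsetP => -[x _ /eqP]; rewrite eq_sym (negbTE (new2 x)).
have [p2 [c2 p12 cp2]] : exists p2 : {set 'I_m.+1 * 'I_m.+1},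
    [/\ config (attach G1 u) (attach G2 v) s1 p2, {subset p1 <= p2}
      & #|p2| = (#|p1| + (u \in idle s p))%N].
  have [/imsetP[q]|_] := boolP (u \in idle s p); last first.
    by exists p1; split; rewrite ?addn0.
  rewrite inE => /andP[sq qp] uq.
  have un : lift ord_max u \notin fst @: p1 by rewrite fp1 mem_imset // uq.
  exists ((lift ord_max u, ord_max) |: p1); split.
  - apply: config_pending => //.
    + by rewrite fs1 mem_imset // uq imset_f.
    + exact: adj_old_new.
    + by rewrite fs1.
    + by rewrite sp1.
  - by move=> e ep; rewrite inE ep orbT.
  - rewrite cardsU1 addnC; congr (_ + nat_of_bool _)%N.
    by apply: contra un => up; apply/imsetP; exists (lift ord_max u, ord_max).
have [/imsetP[q]|_] := boolP (v \in waiting s p); last first.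
  by exists s1, p2; split=> //; rewrite /score cs1 cp2 cp1 addn0 addnA.
rewrite inE => /andP[sq /imsetP[e ep qe]] vq.
have e2 : (lift ord_max q.1, lift ord_max e.2) \in p2.
  by apply: p12; apply/imsetP; exists e => //; rewrite qe.
exists ((lift ord_max e.2, ord_max) |: s1),
  (p2 :\ (lift ord_max q.1, lift ord_max e.2)); split.
  apply: (config_matched c2 e2 (v := lift ord_max v)).
  - by apply/imsetP; exists q => //; rewrite vq.
  - exact: adj_old_new.
  - by rewrite ss1.
have sn : (lift ord_max e.2, ord_max) \notin s1.
  have := mx2 (snd @: s); rewrite -ss1; apply: contra => h.
  by apply/imsetP; exists (lift ord_max e.2, ord_max).
have := cardsD1 (lift ord_max q.1, lift ord_max e.2) p2.
rewrite e2 cp2 cp1 add1n => cp.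
rewrite /score cardsU1 sn cs1 /= -(addnA _ #|p|) cp.
by rewrite mulnDr -addnA add2n addn1 addnS.
Qed.

Lemma degreeE (V : finType) (G : graph V) (x : V) :
  degree G x = (\sum_y adj G x y)%N.
Proof.
rewrite /degree -sum1_card big_mkcond; apply: eq_bigr => y _.
by rewrite inE; case: adj.
Qed.

Section AttachDegree.
Variables (n : nat) (G : graph 'I_n) (u : 'I_n).

Let new_old (x : 'I_n) : (lift ord_max x == ord_max :> 'I_n.+1) = false.
Proof. by rewrite eq_sym (negbTE (neq_lift _ _)). Qed.

Lemma adj_attach_to_new x : adj (attach G u) x ord_max = (x == lift ord_max u).
Proof.
rewrite /adj /attach /edges /= !inE !xpair_eqE eqxx andbT.
rewrite [ord_max == _]eq_sym new_old andbF /=.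
apply/orb_idr => /imsetP[e _ /eqP].
by rewrite xpair_eqE [ord_max == _]eq_sym new_old andbF.
Qed.

Lemma attach_symmetric : symmetric (adj G) -> symmetric (adj (attach G u)).
Proof.
move=> sG x y.
case: (unliftP ord_max x) => [x'|] ->; case: (unliftP ord_max y) => [y'|] ->;
  by rewrite ?adj_attach_old ?adj_attach_new ?adj_attach_to_new.
Qed.

Lemma attach_irreflexive :
  irreflexive (adj G) -> irreflexive (adj (attach G u)).
Proof.
move=> iG x; case: (unliftP ord_max x) => [x'|] ->.
  by rewrite adj_attach_old iG.
by rewrite adj_attach_new eq_sym new_old.
Qed.

Lemma attach_verts : verts G = setT -> verts (attach G u) = setT.
Proof.
move=> vG; apply/setP => x; rewrite /attach {1}/verts /= vG !inE.
case: (unliftP ord_max x) => [x'|] ->; last by rewrite eqxx.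
by rewrite imset_f ?orbT.
Qed.

Lemma degree_attach_old x :
  degree (attach G u) (lift ord_max x) = (degree G x + (x == u))%N.
Proof.
rewrite !degreeE (bigD1_ord ord_max) //= adj_attach_to_new.
rewrite (inj_eq (@lift_inj _ _)) addnC.
by congr (_ + _)%N; apply: eq_bigr => y _; rewrite adj_attach_old.
Qed.

Lemma degree_attach_new : degree (attach G u) ord_max = 1%N.
Proof.
rewrite degreeE (bigD1_ord ord_max) //= adj_attach_new eq_sym new_old add0n.
rewrite (bigD1 u) //= adj_attach_new eqxx big1 ?addn0 // => y /negbTE yu.
by rewrite adj_attach_new (inj_eq (@lift_inj _ _)) yu.
Qed.

Lemma sum_degree_attach :
  (\sum_x degree (attach G u) x = (\sum_x degree G x).+2)%N.
Proof.
rewrite (bigD1_ord ord_max) //= degree_attach_new.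
under eq_bigr do rewrite degree_attach_old.
rewrite big_split /= (bigD1 u (F := fun x => nat_of_bool (x == u))) //= eqxx.
by rewrite [X in (true + X)%N]big1 ?addn0 ?addn1 // => y /negbTE ->.
Qed.

End AttachDegree.

(** The properties of the trees [T_n], [n >= 2], that enter the estimates.
    Positivity of the degrees keeps the value [f 0] out of play. *)
Definition grown (n : nat) (G : graph 'I_n) : Prop :=
  [/\ simple_graph G, verts G = setT, forall x, (0 < degree G x)%N
    & (\sum_x degree G x <= 2 * n)%N].

Lemma simple_graph_setT (V : finType) (G : graph V) :
  symmetric (adj G) -> irreflexive (adj G) -> verts G = setT -> simple_graph G.
Proof. by move=> sG iG vG; split=> // x y _; rewrite vG !inE. Qed.

Lemma grown_attach (n : nat) (G : graph 'I_n) (u : 'I_n) :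
  grown G -> grown (attach G u).
Proof.
move=> [[sG iG _] vG dG sd]; have vG' := attach_verts u vG; split=> //.
- apply: simple_graph_setT => //; first exact: attach_symmetric.
  exact: attach_irreflexive.
- move=> x; case: (unliftP ord_max x) => [y|] ->.
    by rewrite degree_attach_old addn_gt0 dG.
  by rewrite degree_attach_new.
- by rewrite sum_degree_attach mulnS !ltnS.
Qed.

Lemma simple_single_vertex : simple_graph single_vertex.
Proof. by split=> [x y|x|x y]; rewrite /adj !inE. Qed.

Lemma grown_two : grown (attach single_vertex ord0).
Proof.
have [s0 i0 _] := simple_single_vertex.
have v2 := @attach_verts 1 single_vertex ord0 erefl.
have d0 x : degree single_vertex x = 0%N.
  by rewrite degreeE big1 // => y _; rewrite /adj inE.
split=> //.
- apply: simple_graph_setT => //; first exact: attach_symmetric.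
  exact: attach_irreflexive.
- move=> x; case: (unliftP ord_max x) => [y|] ->.
    by rewrite degree_attach_old ord1 d0.
  by rewrite degree_attach_new.
- by rewrite sum_degree_attach big1.
Qed.

(** * Expected growth of the best score *)

Lemma growth_step_sum (R : realType) (f : nat -> R) (n : nat)
    (mu : graph 'I_n -> R) (h : graph 'I_n.+1 -> R) :
  \sum_G' growth_step f mu G' * h G' =
  \sum_G mu G * \sum_(u < n) attach_prob f G u * h (attach G u).
Proof.
rewrite /growth_step.
under eq_bigr do rewrite /= big_distrl /=.
rewrite exchange_big /=; apply: eq_bigr => G _.
under eq_bigr do rewrite -mulrA.
rewrite -mulr_sumr; congr (_ * _).
under [LHS]eq_bigr do rewrite big_distrl /=.
rewrite exchange_big /=; apply: eq_bigr => u _.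
rewrite (bigD1 (attach G u)) //= eqxx mulr1 big1 ?addr0 // => G' /negbTE ->.
by rewrite mulr0 mul0r.
Qed.

Section Growth.
Variables (R : realType) (f : nat -> R) (c C : R).
Hypothesis c_gt0 : 0 < c.
Hypothesis f_ge : forall d, (0 < d)%N -> c <= f d.
Hypothesis f_le : forall d, (0 < d)%N -> f d <= C * d%:R.

Let alpha := c / (2 * C).

Lemma C_gt0 : 0 < C.
Proof.
have := le_trans (@f_ge 1 isT) (@f_le 1 isT); rewrite mulr1.
exact: lt_le_trans.
Qed.

Lemma alpha_gt0 : 0 < alpha.
Proof. by rewrite /alpha divr_gt0 ?mulr_gt0 ?C_gt0. Qed.

Lemma f_gt0 d : (0 < d)%N -> 0 < f d.
Proof. by move=> /f_ge; apply: lt_le_trans. Qed.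

Lemma sum_weight_gt0 n (G : graph 'I_n) : (0 < n)%N -> grown G ->
  0 < \sum_(j < n) f (degree G j).
Proof.
case: n G => // n G _ [_ _ dG _]; rewrite big_ord_recl /=.
apply: ltr_pwDl; first exact: f_gt0.
by apply: sumr_ge0 => j _; apply/ltW/f_gt0.
Qed.

Lemma attach_prob_sum n (G : graph 'I_n) : (0 < n)%N -> grown G ->
  \sum_(u < n) attach_prob f G u = 1.
Proof.
move=> n0 gG; rewrite /attach_prob -mulr_suml divff //.
by rewrite gt_eqF // sum_weight_gt0.
Qed.

(** The numerator is at least [c], and the denominator at most [C] times the sum
    of the degrees. *)
Lemma attach_prob_ge n (G : graph 'I_n) u : grown G ->
  alpha / n%:R <= attach_prob f G u.
Proof.
move=> gG; have n0 : (0 < n)%N by apply: leq_ltn_trans (ltn_ord u).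
have S0 := sum_weight_gt0 n0 gG; case: gG => _ _ dG sG.
have C0 := C_gt0; have nR : 0 < n%:R :> R by rewrite ltr0n.
rewrite /attach_prob ler_pdivlMr //.
apply: le_trans (f_ge (dG u)).
have -> : c = alpha / n%:R * (C * (2 * n%:R)).
  by rewrite /alpha; field; rewrite !gt_eqF.
rewrite ler_wpM2l //; first by rewrite divr_ge0 ?ler0n ?(ltW alpha_gt0).
apply: (@le_trans _ _ (\sum_(j < n) C * (degree G j)%:R)).
  by apply: ler_sum => j _; apply: f_le.
by rewrite -mulr_sumr ler_pM2l // -natr_sum -natrM ler_nat.
Qed.

Lemma attach_prob_ge0 n (G : graph 'I_n) u : grown G -> 0 <= attach_prob f G u.
Proof.
move=> /(attach_prob_ge u); apply: le_trans.
by rewrite divr_ge0 ?ler0n ?(ltW alpha_gt0).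
Qed.

Lemma growing_tree_law2_grown k (G : graph 'I_k.+2) :
  growing_tree_law2 f G != 0 -> grown G.
Proof.
elim: k G => [|k IH] G /=.
  have [-> _|_] := eqVneq G (attach single_vertex ord0); first exact: grown_two.
  by rewrite eqxx.
move=> /eqP nz; apply: contrapT => nG; apply: nz.
rewrite /growth_step big1 // => G' _.
have [->|/IH gG'] := eqVneq (growing_tree_law2 f G') 0; first by rewrite mul0r.
rewrite big1 ?mulr0 // => u _.
case: (G =P attach G' u) => [eG|_]; last by rewrite mulr0.
by case: nG; rewrite eG; apply: grown_attach.
Qed.

Lemma growing_tree_law2_ge0 k (G : graph 'I_k.+2) : 0 <= growing_tree_law2 f G.
Proof.
elim: k G => [|k IH] G /=; first exact: ler0n.
apply: sumr_ge0 => G' _.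
have [->|/growing_tree_law2_grown gG'] := eqVneq (growing_tree_law2 f G') 0.
  by rewrite mul0r.
rewrite mulr_ge0 ?sumr_ge0 // => u _.
by rewrite mulr_ge0 ?ler0n ?attach_prob_ge0.
Qed.

(** Fix a configuration of maximal score: it has [#|s|] chances to gain, each
    of probability at least [alpha / n], and [#|s|] is at least a third of the
    score. *)
Lemma best_score_drift n (G1 G2 : graph 'I_n) : (0 < n)%N ->
    grown G1 -> grown G2 ->
  (1 + alpha / 3 / n%:R) * (best_score G1 G2)%:R <=
  \sum_(u < n) \sum_(v < n) attach_prob f G1 u * attach_prob f G2 v *
    (best_score (attach G1 u) (attach G2 v))%:R.
Proof.
move=> n0 g1 g2; have [_ v1 _ _] := g1; have [_ v2 _ _] := g2.
have [s [p [cs ->]]] : exists s p, config G1 G2 s p /\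
    best_score G1 G2 = score s p.
  by apply: (@best_score_attained _ _ _ _ (Ordinal n0) (Ordinal n0));
    rewrite ?v1 ?v2 inE.
set P := attach_prob f G1; set Q := attach_prob f G2.
have mass (G : graph 'I_n) (A : {set 'I_n}) : grown G ->
    alpha / n%:R * #|A|%:R <= \sum_u attach_prob f G u * (u \in A)%:R.
  move=> gG; rewrite -sum1_card natr_sum mulr_sumr big_mkcond /=.
  apply: ler_sum => u _; case: (u \in A); rewrite ?mulr1 ?mulr0 //.
  exact: attach_prob_ge.
have mP : _ <= \sum_u P u * (u \in idle s p)%:R := mass _ _ g1.
have mQ : _ <= \sum_v Q v * (v \in waiting s p)%:R := mass _ _ g2.
have P0 u : 0 <= P u by apply: attach_prob_ge0.
have Q0 u : 0 <= Q u by apply: attach_prob_ge0.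
have P1 : \sum_u P u = 1 by apply: attach_prob_sum.
have Q1 : \sum_u Q u = 1 by apply: attach_prob_sum.
(* Otherwise [-mulr_suml] would factor the normalising constant out of the
   unfolded attachment probabilities. *)
clearbody P Q.
apply: (@le_trans _ _ (\sum_u \sum_v P u * Q v *
    ((score s p)%:R + (u \in idle s p)%:R + (v \in waiting s p)%:R))).
  have -> : \sum_u \sum_v P u * Q v *
      ((score s p)%:R + (u \in idle s p)%:R + (v \in waiting s p)%:R) =
      (score s p)%:R + \sum_u P u * (u \in idle s p)%:R
      + \sum_v Q v * (v \in waiting s p)%:R.
    transitivity (\sum_u (P u * (score s p)%:R + P u * (u \in idle s p)%:R
        + P u * \sum_v Q v * (v \in waiting s p)%:R)).
      apply: eq_bigr => u _.
      under eq_bigr do rewrite -mulrA.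
      rewrite -mulr_sumr -!mulrDr; congr (_ * _).
      under eq_bigr do rewrite mulrDr.
      by rewrite big_split /= -mulr_suml Q1 mul1r.
    by rewrite !big_split /= -!mulr_suml P1 !mul1r.
  rewrite mulrDl mul1r -addrA lerD2l.
  apply: le_trans (lerD mP mQ).
  rewrite -mulrDr -natrD (card_idle_waiting cs).
  have -> : alpha / 3 / n%:R * (score s p)%:R =
            alpha / n%:R * ((score s p)%:R / 3) by ring.
  rewrite ler_wpM2l //; first by rewrite divr_ge0 ?ler0n ?(ltW alpha_gt0).
  by rewrite ler_pdivrMr // mulrC -natrM ler_nat (score_le cs).
apply: ler_sum => u _; apply: ler_sum => v _; rewrite ler_wpM2l ?mulr_ge0 //.
have [s' [p' [cs' sc]]] := config_attach u v cs.
by rewrite -!natrD -sc ler_nat (score_le_best cs').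
Qed.

Definition mean_best_score (k : nat) : R :=
  \sum_(T1 : graph 'I_k.+2) \sum_(T2 : graph 'I_k.+2)
    growing_tree_law2 f T1 * growing_tree_law2 f T2 * (best_score T1 T2)%:R.

Lemma mean_best_score_step k :
  (1 + alpha / 3 / k.+2%:R) * mean_best_score k <= mean_best_score k.+1.
Proof.
set a : R := 1 + _; rewrite /mean_best_score /=.
under [leRHS]eq_bigr do
  (under eq_bigr do rewrite -mulrA; rewrite -mulr_sumr growth_step_sum).
rewrite growth_step_sum mulr_sumr.
apply: ler_sum => G1 _; rewrite mulr_sumr.
under eq_bigr do rewrite -mulrA mulrCA.
rewrite -mulr_sumr.
have [->|/growing_tree_law2_grown g1] := eqVneq (growing_tree_law2 f G1) 0.
  by rewrite !mul0r.
rewrite ler_wpM2l ?growing_tree_law2_ge0 //.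
under [leRHS]eq_bigr do rewrite mulr_sumr.
rewrite [leRHS]exchange_big /=.
apply: ler_sum => G2 _; rewrite mulrCA.
under [leRHS]eq_bigr do rewrite mulrCA.
rewrite -mulr_sumr.
have [->|/growing_tree_law2_grown g2] := eqVneq (growing_tree_law2 f G2) 0.
  by rewrite !mul0r.
rewrite ler_wpM2l ?growing_tree_law2_ge0 //.
apply: (le_trans (best_score_drift (ltn0Sn _) g1 g2)).
apply: ler_sum => u _; rewrite mulr_sumr; apply: ler_sum => v _.
by rewrite [leRHS]mulrA.
Qed.

(** In the tree on two vertices, both pairs of equal vertices can be matched. *)
Lemma mean_best_score0 : 4 <= mean_best_score 0.
Proof.
set T : graph 'I_2 := attach single_vertex ord0.
set o : 'I_2 := lift ord_max ord0.
have oN : (o == ord_max) = false by rewrite eq_sym (negbTE (neq_lift _ _)).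
have To : adj T o ord_max by apply: adj_old_new.
have vT : verts T = setT by case: grown_two.
have cT : config T T [set (ord_max, ord_max); (o, o)] set0.
  apply/config_of_match/(match_leaf (u := o) (v := o)); rewrite ?inE //.
  - by apply: match_root; rewrite vT inE.
  - by rewrite imset_set1 inE eq_sym oN.
  - by rewrite imset_set1 inE eq_sym oN.
have sT : score [set (ord_max, ord_max); (o, o)]
    (set0 : {set 'I_2 * 'I_2}) = 4%N.
  by rewrite /score cards2 cards0 xpair_eqE eq_sym oN.
rewrite /mean_best_score (bigD1 T) //= [X in _ + X]big1 => [|G /negbTE GT].
  rewrite (bigD1 T) //= [X in _ + X + _]big1 => [|G /negbTE GT].
    rewrite eqxx !mul1r !addr0.
    by rewrite (ler_nat R 4) -sT score_le_best.
  by rewrite GT mulr0 mul0r.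
by rewrite big1 // => G' _; rewrite GT !mul0r.
Qed.

End Growth.

(** * Polynomial growth *)

(** Young's inequality for the numbers [(1 + x) `^ e] and 1, with the
    conjugate exponents [1 / e] and [1 / (1 - e)]. *)
Lemma powR_bernoulli (R : realType) (x e : R) : 0 <= x -> 0 < e -> e < 1 ->
  (1 + x) `^ e <= 1 + e * x.
Proof.
move=> x0 e0 e1; have x1 : 0 <= 1 + x by rewrite addr_ge0.
have e10 : 0 < 1 - e by rewrite subr_gt0.
have := @conjugate_powR R ((1 + x) `^ e) 1 e^-1 (1 - e)^-1 (powR_ge0 _ _) ler01.
rewrite !invr_gt0 !invrK mulr1 -powRrM divff ?gt_eqF // powRr1 // powR1.
move=> /(_ e0 e10); rewrite addrC subrK => /(_ erefl) h.
by apply: le_trans h _; rewrite mul1r; lra.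
Qed.

(** Past some index [k] the ratio [f n / n] is bounded by a real [M]; the
    finitely many earlier values are absorbed by adding the sum of their
    absolute values to the constant. *)
Lemma limn_esup_linear_bound (R : realType) (f : nat -> R) :
  (limn_esup (fun n : nat => (f n / n%:R)%:E) < +oo)%E ->
  exists C : R, forall d : nat, (0 < d)%N -> f d <= C * d%:R.
Proof.
set u := (fun n : nat => _); rewrite limn_esup_lim.
rewrite (cvg_lim (@ereal_hausdorff R) (@cvg_esups_inf R u)).
move=> /ereal_inf_lt[_ [k _ <-] uk].
have [M uM] : exists M : R, forall n, (k <= n)%N -> f n / n%:R <= M.
  have le_u n : (k <= n)%N -> ((f n / n%:R)%:E <= esups u k)%E.
    by move=> kn; apply: ereal_sup_ubound; exists n.
  case: (esups u k) uk le_u => [r _ le_u|//|_ le_u].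
    by exists r => n /le_u; rewrite lee_fin.
  by exists 0 => n /le_u.
exists (`|M| + \sum_(i < k) `|f i|) => d d0.
have dR : 0 < d%:R :> R by rewrite ltr0n.
have S0 : 0 <= \sum_(i < k) `|f i| by apply: sumr_ge0.
have [kd|dk] := leqP k d.
  have := uM d kd; rewrite ler_pdivrMr // => /le_trans; apply.
  rewrite ler_wpM2r ?(ltW dR) //; apply: (le_trans (ler_norm M)).
  by rewrite lerDl.
have fd : f d <= \sum_(i < k) `|f i|.
  rewrite (bigD1 (Ordinal dk)) //=; apply: (le_trans (ler_norm _)).
  by rewrite lerDl sumr_ge0.
apply: le_trans fd _; rewrite mulrDl -[leLHS]add0r lerD ?mulr_ge0 ?(ltW dR) //.
by rewrite ler_peMr // ler1n.
Qed.

Lemma largest_common_single_vertex :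
  (0 < largest_common_subtree single_vertex single_vertex)%N.
Proof.
apply: leq_largest_common_subtree.
have m : tree_match single_vertex single_vertex [set (ord0, ord0)].
  by apply: match_root; rewrite inE.
have := tree_match_common simple_single_vertex simple_single_vertex m.
by rewrite cards1.
Qed.

Section Expectation.
Variables (R : realType) (f : nat -> R) (c C : R).
Hypothesis c_gt0 : 0 < c.
Hypothesis f_ge : forall d, (0 < d)%N -> c <= f d.
Hypothesis f_le : forall d, (0 < d)%N -> f d <= C * d%:R.

Let eps := c / (2 * C) / 3.

(** Induction on [k]: the drift factor [1 + eps / m] beats the growth
    factor [(1 + 1 / m) `^ eps] of the claimed bound. At two vertices
    the claim is implied by [3 * 2 `^ eps <= 4], which holds because
    [eps <= 1 / 6], and this follows from [c <= f 1 <= C]. *)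
Lemma mean_best_score_ge k : 3 * k.+2%:R `^ eps <= mean_best_score f k.
Proof.
have cC : c <= C.
  by have := le_trans (@f_ge 1 isT) (@f_le 1 isT); rewrite mulr1.
have C0 : 0 < C by apply: lt_le_trans cC.
have e0 : 0 < eps by rewrite /eps !divr_gt0 ?mulr_gt0.
have e6 : eps <= 1 / 6.
  have h : eps = c / C / 6 by rewrite /eps; field; rewrite gt_eqF.
  by rewrite h ler_pdivrMr // divfK // ler_pdivrMr // mul1r.
have e1 : eps < 1 by lra.
elim: k => [|k IH].
  apply: le_trans (mean_best_score0 f).
  have := @powR_bernoulli R 1 eps ler01 e0 e1.
  by rewrite (_ : 1 + 1 = 2%:R) //; lra.
apply: le_trans (mean_best_score_step c_gt0 f_ge f_le k).
rewrite -/eps; set m : R := k.+2%:R.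
have m0 : 0 < m by rewrite ltr0n.
have -> : k.+3%:R = m * (1 + m^-1).
  by rewrite mulrDr mulr1 divff ?gt_eqF // natr1.
have mV : 0 <= m^-1 by rewrite invr_ge0 ltW.
rewrite powRM ?(ltW m0) ?addr_ge0 //.
have b := powR_bernoulli mV e0 e1.
rewrite mulrA mulrC; apply: ler_pM => //; first exact: powR_ge0.
by rewrite mulr_ge0 ?powR_ge0.
Qed.

Lemma expected_largest_common_subtree_ge n : (0 < n)%N ->
  n%:R `^ eps <= expected_largest_common_subtree f n.
Proof.
case: n => [//|[_|k _]].
  rewrite powR1 /expected_largest_common_subtree /=.
  rewrite (bigD1 single_vertex) //= (bigD1 single_vertex) //= eqxx !mul1r.
  rewrite -addrA -[leLHS]addr0.
  rewrite lerD ?(ler_nat _ 1) ?largest_common_single_vertex //.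
  by rewrite addr_ge0 // sumr_ge0 // => *; rewrite ?sumr_ge0 // => *;
    rewrite !mulr_ge0 ?ler0n.
rewrite -(ler_pM2l (ltr0n R 3)).
apply: (le_trans (mean_best_score_ge k)).
rewrite /mean_best_score /expected_largest_common_subtree /= mulr_sumr.
apply: ler_sum => G1 _; rewrite mulr_sumr; apply: ler_sum => G2 _.
have [->|/growing_tree_law2_grown[g1 v1 _ _]] :=
  eqVneq (growing_tree_law2 f G1) 0; first by rewrite !mul0r mulr0.
have [->|/growing_tree_law2_grown[g2 v2 _ _]] :=
  eqVneq (growing_tree_law2 f G2) 0; first by rewrite mulr0 !mul0r mulr0.
rewrite mulrCA; apply: ler_wpM2l.
  by rewrite mulr_ge0 ?(growing_tree_law2_ge0 c_gt0 f_ge f_le).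
by rewrite -natrM ler_nat best_score_le // ?v1 ?v2;
  apply/set0Pn; exists ord0; rewrite inE.
Qed.

End Expectation.

Local Open Scope classical_set_scope.

Theorem theorem1p4 (R : realType) (f : nat -> R)
    (f_pos : forall n : nat, (0 < n)%N -> 0 < f n)
    (f_linear : (limn_esup (fun n : nat => (f n / n%:R)%:E) < +oo)%E)
    (f_inf : 0 < inf [set f n | n in [set n : nat | (0 < n)%N]]) :
  exists eps : R, 0 < eps /\
    forall n : nat, (0 < n)%N ->
      n%:R `^ eps <= expected_largest_common_subtree f n.
Proof.
have [C fC] := limn_esup_linear_bound f_linear.
set c := inf _ in f_inf.
have fc d : (0 < d)%N -> c <= f d.
  move=> d0; apply: ge_inf; last by exists d.
  by exists 0 => _ [n n0 <-]; apply/ltW/f_pos.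
exists (c / (2 * C) / 3); split.
  by rewrite divr_gt0 ?(alpha_gt0 f_inf fc fC).
by move=> n; apply: expected_largest_common_subtree_ge.
Qed.
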